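(* Let $n,k>0$ be integers, let $P_n$ be the path on $n$ vertices, and let $m:=\lfloor n/(3k+2)\rfloor$. Then \[\beta_k(P_n)=\begin{cases}1, & \text{if } n=1;\\ 2m, & \text{if } n\bmod (3k+2)\in\{0,1\} \text{ (and } n\neq 1);\\ 2m+1, & \text{if } n \bmod (3k+2)\in\{2,\dots,k+2\};\\ 2m+2, & \text{if } n\bmod(3k+2)\in\{k+3,\dots,3k+1\}.\end{cases}\]
   Context: For a graph $G=(V,E)$ with geodesic (shortest-path) distance $d$, and an integer $k\ge 0$, define $d_k(u,v):=\min\{d(u,v),k+1\}$. A non-empty set $R\subseteq V$ is a $k$-truncated resolving set of $G$ if for all $u,v\in V$, $d_k(u,r)=d_k(v,r)$ for every $r\in R$ implies $u=v$. The $k$-truncated metric dimension $\beta_k(G)$ is the minimum size of a $k$-truncated resolving set of $G$. *)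

(* Defs.v *)
From mathcomp Require Import all_boot.

Set Implicit Arguments.
Unset Strict Implicit.
Unset Printing Implicit Defensive.

Record sgraph := SGraph {
  vertex :> finType;
  adj : rel vertex;
  adj_sym : symmetric adj;
  adj_irr : irreflexive adj
}.

Section TruncatedMetricDimension.
Variables (G : sgraph) (k : nat).
Implicit Types (u v : G) (R : {set G}).

Definition has_walk u v (l : nat) : bool :=
  [exists p : l.-tuple G, path (@adj G) u p && (last u p == v)].

Lemma connect_has_walk u v :
  connect (@adj G) u v -> exists l, has_walk u v l.
Proof.
case/connectP=> p pP ->; exists (size p).
by apply/existsP; exists (in_tuple p); rewrite pP eqxx.
Qed.

(* None stands for an infinite distance. *)
Definition gdist u v : option nat :=
  match boolP (connect (@adj G) u v) with
  | AltTrue cuv => Some (ex_minn (connect_has_walk cuv))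
  | AltFalse _ => None
  end.

Definition trunc_dist u v : nat :=
  if gdist u v is Some d then minn d k.+1 else k.+1.

Definition trunc_resolving R : bool :=
  (R != set0) &&
  [forall u, forall v,
     [forall r in R, trunc_dist u r == trunc_dist v r] ==> (u == v)].

Lemma trunc_dist_eq0 u v : (trunc_dist u v == 0) = (u == v).
Proof.
rewrite /trunc_dist /gdist; case: {-}_ / (boolP _) => [c|nc].
  case: ex_minnP => d /existsP[p /andP[pP /eqP lp]] dmin.
  rewrite -leqn0 geq_min leqn0 orbF; apply/eqP/eqP => [d0|uv].
    by move: p pP lp {dmin}; rewrite d0 => p; rewrite tuple0.
  apply/eqP; rewrite -leqn0; apply: dmin.
  by apply/existsP; exists [tuple]; rewrite /= uv eqxx.
by apply/esym/negP => /eqP uv; rewrite uv connect0 in nc.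
Qed.

Lemma trunc_resolvingT : 0 < #|G| -> trunc_resolving [set: G].
Proof.
move=> G0; apply/andP; split; first by rewrite -card_gt0 cardsT.
apply/forallP=> u; apply/forallP=> v; apply/implyP=> /forall_inP uv.
by rewrite -trunc_dist_eq0 (eqP (uv v _)) ?inE // trunc_dist_eq0.
Qed.

(* By trunc_resolvingT the default set is itself resolving as soon as G has a
   vertex, so this is then a minimum over all truncated resolving sets. *)
Definition trunc_metric_dim : nat :=
  #|[arg min_(R < [set: G] | trunc_resolving R) #|R| ]|.

End TruncatedMetricDimension.

Section PathGraph.
Variable n : nat.

Definition path_adj : rel 'I_n := fun i j => (i.+1 == j) || (j.+1 == i).

Lemma path_adj_sym : symmetric path_adj.
Proof. by move=> i j; rewrite /path_adj orbC. Qed.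

Lemma path_adj_irr : irreflexive path_adj.
Proof. by move=> i; rewrite /path_adj orbb eqn_leq ltnn. Qed.

Definition path_graph : sgraph := SGraph path_adj_sym path_adj_irr.

End PathGraph.

(* Main.v *)
(** A landmark [p] separates two vertices within distance [k] of it unless they
are mirror images [p - i], [p + i], and at most one vertex may be further than
[k] from all landmarks.  Two landmarks at distance [k + 1] fully resolve a block
of [3k + 2] vertices, which gives the upper bound block by block.  Conversely, a
landmark which is not an end of the path must have another landmark within
[k + 1], in order to separate its two neighbours.  Reading the landmarks from
left to right, one that is near its predecessor, or at an end of the path, covers
at most [k + 1] new vertices, and any other one is followed by a near one, the
two covering at most [3k + 2] new vertices. *)

Require Import Defs.
From mathcomp Require Import all_boot.
From mathcomp Require Import zify.

(** * Truncated distances in a path *)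

Definition distn (u v : nat) := (u - v) + (v - u).

(** [c] is the neighbour of [a] one step towards [b]; the bound by [maxn a b] keeps the walk inside
    the path. *)
Lemma distn_step a b d :
  distn a b = d.+1 ->
  let c := if a < b then a.+1 else a.-1 in
  [/\ distn c b = d, c <= maxn a b & (a.+1 == c) || (c.+1 == a)].
Proof. by rewrite /distn; case: ifP => ab abd /=; split; lia. Qed.

Lemma distn_adj a b c d :
  (a.+1 == b) || (b.+1 == a) -> distn b c <= d -> distn a c <= d.+1.
Proof. by rewrite /distn; lia. Qed.

Section PathDistance.
Variable n : nat.
Implicit Types u v : path_graph n.

Lemma path_walk d u v :
  distn u v = d ->
  exists p : seq (path_graph n),
    [/\ size p = d, path (@adj (path_graph n)) u p & last u p = v].
Proof.
elim: d u => [|d IHd] u uvd.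
  exists [::]; split=> //=; apply: val_inj => /=.
  by move: uvd; rewrite /distn; lia.
have [cv c_le uc] := distn_step _ _ _ uvd.
have c_lt_n : (if u < v then u.+1 else u.-1) < n.
  by apply: leq_ltn_trans c_le _; rewrite gtn_max !ltn_ord.
have [p [sp pp lp]] := IHd (Ordinal c_lt_n : path_graph n) cv.
by exists ((Ordinal c_lt_n : path_graph n) :: p); rewrite /= sp pp andbT.
Qed.

Lemma distn_le_walk u (p : seq (path_graph n)) :
  path (@adj (path_graph n)) u p -> distn u (last u p) <= size p.
Proof.
elim: p u => [|w p IHp] u /=; first by rewrite /distn; lia.
by case/andP=> uw /IHp; apply: distn_adj.
Qed.

Lemma trunc_dist_path k u v : trunc_dist k u v = minn (distn u v) k.+1.
Proof.
have [p [sp pp lp]] := path_walk _ _ _ (erefl (distn u v)).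
have cuv : connect (@adj (path_graph n)) u v by apply/connectP; exists p.
rewrite /trunc_dist /gdist; case: {-}_ / (boolP _) => [c|]; last by rewrite cuv.
case: ex_minnP => d /existsP[q /andP[qq /eqP lq]] dmin.
suff -> : d = distn u v by [].
apply/eqP; rewrite eqn_leq; apply/andP; split.
  apply: dmin; rewrite -sp; apply/existsP; exists (in_tuple p).
  by rewrite pp lp eqxx.
by rewrite -(size_tuple q) -lq; apply: distn_le_walk.
Qed.

End PathDistance.

(** * Resolving sets as lists of positions *)

(** Landmarks are plain numbers, so that solutions for shorter paths can be shifted and
    concatenated. *)
Definition resolves (k n : nat) (L : seq nat) :=
  forall u v, u < n -> v < n ->
  {in L, forall x, minn (distn u x) k.+1 = minn (distn v x) k.+1} -> u = v.

Lemma trunc_resolving_pathP n k (R : {set path_graph n}) :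
  trunc_resolving k R <->
  R != set0 /\ resolves k n [seq val i | i : 'I_n <- enum R].
Proof.
split=> [/andP[R0 /forallP Rres]|[R0 Rres]].
  split=> // u v un vn uvR.
  have /forallP/(_ (Ordinal vn))/implyP := Rres (Ordinal un).
  move=> uv; suff /uv/eqP[] : [forall r in R,
    trunc_dist k (Ordinal un : path_graph n) r
      == trunc_dist k (Ordinal vn : path_graph n) r] by [].
  apply/forall_inP=> x xR; rewrite !trunc_dist_path /=; apply/eqP/uvR.
  by apply/mapP; exists x; rewrite ?mem_enum.
apply/andP; split=> //; apply/forallP=> u; apply/forallP=> v.
apply/implyP=> /forall_inP uvR; apply/eqP/val_inj.
apply: Rres; rewrite ?ltn_ord // => _ /mapP[x xR ->].
by have := uvR x; rewrite -mem_enum xR !trunc_dist_path => /(_ isT)/eqP.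
Qed.

Lemma trunc_metric_dim_min n k (n_gt0 : 0 < n) :
  (exists2 R : {set path_graph n},
     trunc_resolving k R & #|R| = trunc_metric_dim (path_graph n) k) /\
  (forall R : {set path_graph n},
     trunc_resolving k R -> trunc_metric_dim (path_graph n) k <= #|R|).
Proof.
rewrite /trunc_metric_dim; case: arg_minnP => [|R Rres Rmin].
  by apply: trunc_resolvingT; rewrite card_ord.
by split=> //; exists R.
Qed.

(** * Upper bound *)

Lemma trunc_metric_dim_le n k L :
  0 < n -> L != [::] -> all (gtn n) L -> resolves k n L ->
  trunc_metric_dim (path_graph n) k <= size L.
Proof.
move=> n_gt0 L0 /allP Ln Lres; have [_ dim_min] := trunc_metric_dim_min n k n_gt0.
pose R : {set path_graph n} := [set i : 'I_n | val i \in L].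
have memR x : x \in L -> x \in [seq val i | i : 'I_n <- enum R].
  move=> xL; apply/mapP; exists (Ordinal (Ln _ xL)) => //.
  by rewrite mem_enum inE.
apply: leq_trans (dim_min R _) _.
  apply/trunc_resolving_pathP; split.
    case: L L0 Ln @R memR {Lres dim_min} => // x L _ Ln R memR.
    by apply/set0Pn; exists (Ordinal (Ln x (mem_head _ _))); rewrite inE mem_head.
  by move=> u v un vn uvR; apply: Lres => // x /memR; apply: uvR.
rewrite cardE -(size_map (fun i : 'I_n => val i)); apply: uniq_leq_size.
  by rewrite map_inj_uniq ?enum_uniq //; apply: val_inj.
by move=> _ /mapP[x xR ->]; move: xR; rewrite mem_enum inE.
Qed.

Lemma resolves_endpoint k n : n <= k.+2 -> resolves k n [:: 0].
Proof. by move=> nk u v un vn /(_ 0 (mem_head _ _)); rewrite /distn; lia. Qed.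

(** The balls of radius [k] around the two landmarks cover all [n] vertices, and as [d <= k.+1],
    mirror images about one landmark are separated by the other. *)
Lemma resolves_pair k n d :
  0 < d <= k.+1 -> n <= (k + d) + k.+1 -> resolves k n [:: k; k + d].
Proof.
move=> dk nk u v un vn uv.
have := uv k (mem_head _ _); have := uv (k + d).
by rewrite !inE eqxx orbT => /(_ isT); rewrite /distn; lia.
Qed.

Lemma resolves_add_block k n L :
  resolves k n L ->
  resolves k (n + (3 * k + 2))
    [:: k, k + k.+1 & [seq x + (3 * k + 2) | x <- L]].
Proof.
set B := 3 * k + 2 => Lres u v un vn uv.
have k_in : minn (distn u k) k.+1 = minn (distn v k) k.+1.
  by apply: uv; rewrite mem_head.
have k1_in : minn (distn u (k + k.+1)) k.+1 = minn (distn v (k + k.+1)) k.+1.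
  by apply: uv; rewrite !inE eqxx orbT.
(* A vertex of the block is within [k] of [k] or [k + k.+1], and these two landmarks identify it
   among all vertices; beyond the block, the shifted copy of [L] decides. *)
have [uB|uB] := ltnP u B; first by move: k_in k1_in; rewrite /distn; lia.
have [vB|vB] := ltnP v B; first by move: k_in k1_in; rewrite /distn; lia.
suff : u - B = v - B by lia.
apply: Lres; [lia|lia|move=> x xL].
have := uv (x + B); rewrite 2!inE (map_f (addn^~ B) xL) !orbT => /(_ isT).
have dE w : B <= w -> distn w (x + B) = distn (w - B) x by rewrite /distn; lia.
by rewrite !dE.
Qed.

Lemma resolves_blocks k r L m :
  all (gtn r) L -> resolves k r L ->
  exists L', [/\ size L' = 2 * m + size L, all (gtn (m * (3 * k + 2) + r)) L'
               & resolves k (m * (3 * k + 2) + r) L'].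
Proof.
set B := 3 * k + 2 => Lr Lres; elim: m => [|m [L' [sL' L'n L'res]]].
  by exists L.
exists [:: k, k + k.+1 & [seq x + B | x <- L']]; split.
- by rewrite /= size_map sL'; lia.
- rewrite /= all_map mulSn; apply/and3P; split; [lia|lia|].
  by apply: sub_all L'n => x /=; lia.
- by rewrite mulSn (_ : _ + r = m * B + r + B); [apply: resolves_add_block|lia].
Qed.

Lemma trunc_metric_dim_le_blocks k r L m :
  0 < 2 * m + size L -> 0 < m * (3 * k + 2) + r ->
  all (gtn r) L -> resolves k r L ->
  trunc_metric_dim (path_graph (m * (3 * k + 2) + r)) k <= 2 * m + size L.
Proof.
move=> + + Lr Lres.
have [L' [<- L'n L'res]] := resolves_blocks k r L m Lr Lres => L'_gt0 n_gt0.
apply: trunc_metric_dim_le => //.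
by apply: contraTneq L'_gt0 => ->.
Qed.

(** * Lower bound *)

Definition covered (k : nat) (L : seq nat) (v : nat) :=
  has (fun x => distn v x <= k) L.

Definition ncovered (k n : nat) (L : seq nat) :=
  count (covered k L) (iota 0 n).

Definition max_covered (k s : nat) := s./2 * (3 * k + 2) + odd s * k.+1.

Lemma count_window n (P Q : pred nat) a d :
  (forall v, v < n -> P v -> ~~ Q v -> a <= v < a + d) ->
  count P (iota 0 n) <= count Q (iota 0 n) + d.
Proof.
move=> PQ; pose W v := a <= v < a + d.
apply: (@leq_trans (count (predU Q W) (iota 0 n))).
  rewrite -!size_filter; apply: uniq_leq_size; first exact/filter_uniq/iota_uniq.
  move=> v; rewrite !mem_filter mem_iota /= add0n => /andP[Pv vn].
  by rewrite vn andbT; case: (boolP (Q v)) => //= nQ; apply: PQ.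
rewrite -(leq_add2r (count (predI Q W) (iota 0 n))) count_predUI.
rewrite -addnA leq_add2l; apply: leq_trans (leq_addr _ _).
rewrite -size_filter -[d in _ <= d](size_iota a); apply: uniq_leq_size.
  exact/filter_uniq/iota_uniq.
by move=> v; rewrite mem_filter => /andP[Wv _]; rewrite mem_iota.
Qed.

Lemma ncovered_rcons k n L x a d :
  (forall v, v < n -> distn v x <= k -> ~~ covered k L v -> a <= v < a + d) ->
  ncovered k n (rcons L x) <= ncovered k n L + d.
Proof.
move=> xd; apply: (@count_window n _ _ a) => v vn.
by rewrite /covered has_rcons => /orP[vx nL|->//]; apply: xd.
Qed.

Lemma ncovered_rcons_any k n L x :
  ncovered k n (rcons L x) <= ncovered k n L + (2 * k + 1).
Proof. by apply: (@ncovered_rcons k n L x (x - k)) => v _; rewrite /distn; lia. Qed.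

(** The vertices from [x - k] to [x - 1] are within [k] of [y], so only those from [x] to [x + k]
    can be new. *)
Lemma ncovered_rcons_close k n L x y :
  y \in L -> y < x <= y + k.+1 ->
  ncovered k n (rcons L x) <= ncovered k n L + k.+1.
Proof.
move=> yL yx; apply: (@ncovered_rcons k n L x x) => v _ vx /hasPn/(_ y yL).
by move: vx; rewrite /distn; lia.
Qed.

Lemma ncovered_rcons_end k n L x :
  x = 0 \/ x = n.-1 -> ncovered k n (rcons L x) <= ncovered k n L + k.+1.
Proof.
case=> x_end.
  by apply: (@ncovered_rcons k n L x x) => v _; rewrite /distn; lia.
by apply: (@ncovered_rcons k n L x (x - k)) => v vn; rewrite /distn; lia.
Qed.

Definition not_isolated (k n : nat) (L : seq nat) (x : nat) :=
  [\/ x = 0, x = n.-1 | exists2 y : nat, y \in L & 0 < distn x y <= k.+1].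

Lemma ncovered_le k n L :
  sorted ltn L -> {in L, forall x, not_isolated k n L x} ->
  ncovered k n L <= max_covered k (size L).
Proof.
move=> Lsorted Lni.
(* The bound grows by [3 * k + 2] per two landmarks, and by [k.+1] or [2 * k + 1] per single one. *)
have max2 s : max_covered k s + (3 * k + 2) = max_covered k s.+2.
  by rewrite /max_covered /= negbK mulSn; lia.
have max1 s : max_covered k s + k.+1 <= max_covered k s.+1.
  by rewrite /max_covered /= uphalf_half; case: (odd s); rewrite ?mulSn /=; lia.
(* [l0] is the part already read. The bound [c] on the unread part serves for strong induction,
   since one or two landmarks are read at a time. *)
suff extend c l l0 : size l <= c -> L = l0 ++ l ->
    ncovered k n l0 <= max_covered k (size l0) ->
    ncovered k n L <= max_covered k (size L).
  apply: (extend _ L [::] (leqnn _)) => //.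
  by rewrite /ncovered /covered /= count_pred0.
elim: c l l0 => [|c IHc] [|x l] l0 //= lc LE l0cov; try by rewrite LE cats0.
have Lpw : pairwise ltn (l0 ++ x :: l).
  by rewrite -LE -(sorted_pairwise ltn_trans).
move: Lpw; rewrite pairwise_cat => /and3P[/allrelP l0_lt _ /= /andP[x_lt l_pw]].
have add1 : ncovered k n (rcons l0 x) <= ncovered k n l0 + k.+1 ->
    ncovered k n L <= max_covered k (size L).
  move=> xcov; apply: (IHc l (rcons l0 x)) => //; first by rewrite LE cat_rcons.
  rewrite size_rcons; apply: leq_trans (max1 _).
  by apply: leq_trans xcov _; rewrite leq_add2r.
have /Lni[x0|xn|[y yL xy]] : x \in L by rewrite LE mem_cat mem_head orbT.
- by apply/add1/ncovered_rcons_end; left.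
- by apply/add1/ncovered_rcons_end; right.
move: yL; rewrite {1}LE mem_cat inE => /or3P[yl0|/eqP yx|yl].
- apply/add1/(ncovered_rcons_close k n l0 x y yl0).
  by have := l0_lt y x yl0 (mem_head _ _); move: xy; rewrite /distn; lia.
- by move: xy; rewrite yx /distn; lia.
case: l lc LE {l0_lt add1} x_lt l_pw yl => // z l lc LE x_lt /= /andP[z_lt _] yl.
(* The next landmark [z] lies between [x] and [y], hence is also near [x]: [x] adds at most
   [2 * k + 1] vertices and [z] at most [k.+1]. *)
have zx : x < z by move: x_lt => /= /andP[].
have zy : z <= y.
  by move: yl; rewrite inE => /predU1P[->//|/(allP z_lt)/ltnW].
apply: (IHc l (rcons (rcons l0 x) z)).
- by move: lc => /=; lia.
- by rewrite LE !cat_rcons.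
rewrite !size_rcons -max2.
have xz : x < z <= x + k.+1 by move: xy; rewrite /distn; lia.
have xin : x \in rcons l0 x by rewrite mem_rcons mem_head.
apply: leq_trans (ncovered_rcons_close k n _ z x xin xz) _.
have -> c' : c' + (3 * k + 2) = c' + (2 * k + 1) + k.+1 by lia.
rewrite leq_add2r; apply: leq_trans (ncovered_rcons_any k n l0 x) _.
by rewrite leq_add2r.
Qed.

Lemma resolves_not_isolated k n L :
  0 < k -> resolves k n L -> {in L, forall x, x < n -> not_isolated k n L x}.
Proof.
move=> k_gt0 Lres x xL xn.
have [x0|x_gt0] := posnP x; first exact: Or31.
have [xn1|xn1] := eqVneq x n.-1; first exact: Or32.
case: (boolP (has (fun y => 0 < distn x y <= k.+1) L)) => [/hasP|/hasPn far].
  exact: Or33.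
(* Both neighbours are at distance 1 from [x], and at least [k.+1] from every other landmark. *)
suff : x.-1 = x.+1 by lia.
by apply: Lres => [||y /far]; rewrite /distn; lia.
Qed.

(** An uncovered vertex has truncated distance [k.+1] to every landmark, so there is at most one. *)
Lemma resolves_ncovered k n L : resolves k n L -> n <= (ncovered k n L).+1.
Proof.
move=> Lres; rewrite -[n in n <= _](size_iota 0) -(count_predC (covered k L)).
rewrite -addn1 leq_add2l -size_filter.
set U := filter _ _; have: uniq U by exact/filter_uniq/iota_uniq.
have Ueq : {in U &, forall u v, u = v}.
  move=> u v; rewrite !mem_filter !mem_iota !add0n /=.
  move=> /andP[/hasPn uL un] /andP[/hasPn vL vn].
  by apply: Lres => // x xL; have := uL x xL; have := vL x xL; lia.
case: U Ueq => [|u [|v U]] // Ueq /=.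
by rewrite inE (Ueq u v) ?inE ?eqxx ?orbT.
Qed.

Lemma trunc_metric_dim_ge n k :
  0 < n -> 0 < k ->
  let beta := trunc_metric_dim (path_graph n) k in
  0 < beta /\ n <= (max_covered k beta).+1.
Proof.
move=> n_gt0 k_gt0; have [[R Rres <-] _] := trunc_metric_dim_min n k n_gt0.
move/trunc_resolving_pathP: Rres => [R0 Rres] /=; rewrite card_gt0; split=> //.
apply: leq_trans (resolves_ncovered _ _ _ Rres) _; rewrite ltnS.
set L := map _ _ in Rres *.
have -> : #|R| = size L by rewrite size_map cardE.
apply: ncovered_le => [|x xL].
  apply: (@subseq_sorted _ _ ltn_trans _ (iota 0 n)); last exact: iota_ltn_sorted.
  by rewrite -val_enum_ord; apply/map_subseq; rewrite enumT; apply: filter_subseq.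
by apply: resolves_not_isolated => //; case/mapP: xL => i _ ->; apply: ltn_ord.
Qed.

(** * Comparison of the two bounds *)

Theorem theorem1 (n k : nat) (n_gt0 : 0 < n) (k_gt0 : 0 < k) :
  let m := n %/ (3 * k + 2) in
  let r := n %% (3 * k + 2) in
  let beta := trunc_metric_dim (path_graph n) k in
  [/\ n = 1 -> beta = 1,
      n <> 1 -> 0 <= r <= 1 -> beta = 2 * m,
      2 <= r <= k + 2 -> beta = 2 * m + 1
    & k + 3 <= r <= 3 * k + 1 -> beta = 2 * m + 2].
Proof.
move=> m r beta.
have nE : n = m * (3 * k + 2) + r by apply: divn_eq.
have [beta_gt0 n_le] := trunc_metric_dim_ge n k n_gt0 k_gt0.
have beta_le L : 0 < 2 * m + size L -> all (gtn r) L -> resolves k r L ->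
    beta <= 2 * m + size L.
  rewrite /beta => sL Lr Lres; clearbody m r; subst n.
  exact: trunc_metric_dim_le_blocks.
rewrite -/beta in beta_gt0 n_le.
have [j [b betaE]] : exists j (b : bool), beta = 2 * j + b.
  by exists beta./2, (odd beta); rewrite -[LHS]odd_double_half; lia.
have {n_le} n_le : n <= j * (3 * k + 2) + b * k.+1 + 1.
  move: n_le; rewrite /max_covered betaE.
  have -> : (2 * j + b)./2 = j by lia.
  have -> : odd (2 * j + b) = b by lia.
  by lia.
have mulB i i' : i < i' -> i * (3 * k + 2) + (3 * k + 2) <= i' * (3 * k + 2).
  by move=> ii'; rewrite addnC -mulSn leq_mul2r ii' orbT.
(* Otherwise [n] would be at least [j * (3 * k + 2) + (3 * k + 2)], which exceeds the bound because
   [k > 0]. *)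
have jm : m <= j.
  rewrite leqNgt; apply/negP=> /mulB; case: b n_le {betaE} => /=; lia.
have le_endpoint : 0 < r <= k.+2 -> beta <= 2 * m + 1.
  move=> r1; apply: (beta_le [:: 0]); [by rewrite addn1|by rewrite /=; lia|].
  by apply: resolves_endpoint; lia.
clear mulB.
clearbody beta m r; split=> [n1|n1 r1|r2|r3].
- have m0 : m = 0 by case: m nE {beta_le jm le_endpoint} => //; lia.
  by subst m; have := le_endpoint; lia.
- have m_gt0 : 0 < m by case: m nE {beta_le jm le_endpoint}; lia.
  (* At most one vertex remains after the blocks, so the empty list resolves the remainder. *)
  have := beta_le [::]; rewrite /= addn0 muln_gt0 m_gt0 => /(_ isT isT) le_m.
  suff : beta <= 2 * m by lia.
  by apply: le_m => u v; lia.
(* If [j = m], then [r >= 2] forces [b] to be true; [j > m] would contradict the upper bound. *)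
- have := le_endpoint; have [jE|] := eqVneq j m; last by lia.
  by move: n_le betaE; rewrite nE jE; case: b => /=; lia.
- suff : beta <= 2 * m + 2.
    have [jE|] := eqVneq j m; last by lia.
    by move: n_le betaE; rewrite nE jE; case: b => /=; lia.
  (* The second landmark is placed as in a full block, but no further than the last vertex [r.-1] of
     the remainder. *)
  have kd : k + (minn (2 * k + 1) r.-1 - k) = minn (2 * k + 1) r.-1 by lia.
  apply: (beta_le [:: k; minn (2 * k + 1) r.-1]); rewrite /= ?addn_gt0 ?orbT //.
    by lia.
  by rewrite -kd; apply: resolves_pair; lia.
Qed.
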